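(* Let $R$ be a ring and $\alpha$ a ring endomorphism of $R$. The skew power series ring $R[[x;\alpha]]$ is a $U\sqrt{\Delta}$-ring if and only if $R$ is a $U\sqrt{\Delta}$-ring.
   Context: All rings are associative with identity and ring endomorphisms preserve the identity. $R[[x;\alpha]]$ is the ring of formal power series $\sum_{i\ge 0}a_ix^i$ with $a_i\in R$ and multiplication determined by $xr=\alpha(r)x$ for $r\in R$. For a ring $R$, $U(R)$ is its group of units, $\Delta(R)=\{x\in R \mid x+u\in U(R)\text{ for all }u\in U(R)\}$, and $\sqrt{\Delta(R)}=\{x\in R\mid x^n\in\Delta(R)\text{ for some integer }n\ge 1\}$. A ring $R$ is a $U\sqrt{\Delta}$-ring if every non-unit $a\in R$ can be written as $a=ub$ with $u\in U(R)$ and $b\in\sqrt{\Delta(R)}$. *)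

(* Defs.v *)
From HB Require Import structures.
From mathcomp Require Import all_boot all_order all_algebra.
From mathcomp Require Import boolp.

Set Implicit Arguments.
Unset Strict Implicit.
Unset Printing Implicit Defensive.

Import GRing.Theory.
Local Open Scope ring_scope.

(** Rings are [pzRingType]s: associative with identity, not necessarily
    commutative, possibly zero.  [GRing.unit] would need a [unitRingType], i.e.
    a nonzero ring with a chosen inverse function, hence a predicate. *)

Section USqrtDelta.
Variable R : pzRingType.
Implicit Types x u : R.

Definition is_unit u : Prop := exists v : R, v * u = 1 /\ u * v = 1.

Definition Delta x : Prop := forall u, is_unit u -> is_unit (x + u).

Definition sqrtDelta x : Prop := exists2 n : nat, (0 < n)%N & Delta (x ^+ n).

Definition USqrtDelta_ring : Prop :=
  forall a : R, ~ is_unit a ->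
    exists u b : R, [/\ is_unit u, sqrtDelta b & a = u * b].

End USqrtDelta.

Lemma is_unitP (R : unitRingType) (x : R) :
  reflect (is_unit x) (x \is a GRing.unit).
Proof. exact: unitrP. Qed.

Section IterRMorphism.
Variables (R : pzRingType) (alpha : {rmorphism R -> R}).

Definition iter_rmorph (i : nat) : R -> R := iter i alpha.

Fact iter_rmorph_is_zmod_morphism i : zmod_morphism (iter_rmorph i).
Proof.
rewrite /iter_rmorph => a b; elim: i => //= i ->; exact: rmorphB.
Qed.

Fact iter_rmorph_is_monoid_morphism i : monoid_morphism (iter_rmorph i).
Proof.
rewrite /iter_rmorph; split=> [|a b]; elim: i => //= i ->.
  exact: rmorph1.
exact: rmorphM.
Qed.

HB.instance Definition _ i := GRing.isZmodMorphism.Build R R (iter_rmorph i)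
  (iter_rmorph_is_zmod_morphism i).
HB.instance Definition _ i := GRing.isMonoidMorphism.Build R R (iter_rmorph i)
  (iter_rmorph_is_monoid_morphism i).

Lemma iter_rmorph_comp i j a :
  iter_rmorph i (iter_rmorph j a) = iter_rmorph (i + j) a.
Proof. by rewrite /iter_rmorph iterD. Qed.

End IterRMorphism.

(** [skew_pseries alpha] is R[[x; alpha]]; [scoef f i] is the coefficient a_i
    of the series f = \sum_i a_i x^i.  A record rather than [nat -> R], which
    may carry a pointwise ring structure. *)

Record skew_pseries (R : pzRingType) (alpha : {rmorphism R -> R}) :=
  SkewPSeries { scoef : nat -> R }.

Section SkewPSeriesRing.
Variables (R : pzRingType) (alpha : {rmorphism R -> R}).
Local Notation S := (skew_pseries alpha).
Implicit Types f g h : S.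

HB.instance Definition _ := [isNew for @scoef R alpha].
HB.instance Definition _ := [Equality of S by <:].
HB.instance Definition _ := [Choice of S by <:].

Lemma skew_pseriesP f g : scoef f =1 scoef g <-> f = g.
Proof.
split=> [|-> //]; case: f g => [f] [g] /= fg; congr SkewPSeries; exact/funext.
Qed.

Definition skew_const (a : R) : S := SkewPSeries alpha (fun i => a *+ (i == 0)%N).
Definition skewX : S := SkewPSeries alpha (fun i => (i == 1)%N%:R).

Definition skew_zero : S := SkewPSeries alpha (fun=> 0).
Definition skew_opp f : S := SkewPSeries alpha (fun i => - scoef f i).
Definition skew_add f g : S := SkewPSeries alpha (fun i => scoef f i + scoef g i).

(* (a x^i) (b x^j) = a alpha^i(b) x^(i + j), by iterating x r = alpha(r) x *)
Definition skew_mul f g : S := SkewPSeries alpha (fun n =>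
  \sum_(i < n.+1) scoef f i * iter_rmorph alpha i (scoef g (n - i)%N)).

Fact skew_addA : associative skew_add.
Proof. by move=> f g h; apply/skew_pseriesP => i /=; rewrite addrA. Qed.

Fact skew_addC : commutative skew_add.
Proof. by move=> f g; apply/skew_pseriesP => i /=; rewrite addrC. Qed.

Fact skew_add0 : left_id skew_zero skew_add.
Proof. by move=> f; apply/skew_pseriesP => i /=; rewrite add0r. Qed.

Fact skew_addN : left_inverse skew_zero skew_opp skew_add.
Proof. by move=> f; apply/skew_pseriesP => i /=; rewrite addNr. Qed.

Fact skew_mulA : associative skew_mul.
Proof.
move=> f g h; apply/skew_pseriesP => n /=.
have rev F : \sum_(i < n.+1) F (i : nat) = \sum_(i < n.+1) F (n - i)%N :> R.
  by rewrite (reindex_inj rev_ord_inj) /=; apply: eq_bigr => i _; rewrite subSS.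
pose c j k := scoef f j * iter_rmorph alpha j (scoef g (n - j - k)%N)
                * iter_rmorph alpha (n - k) (scoef h k).
rewrite [RHS](rev (fun i => (\sum_(j < i.+1) scoef f j *
  iter_rmorph alpha j (scoef g (i - j)%N)) * iter_rmorph alpha i (scoef h (n - i)%N))).
transitivity (\sum_(j < n.+1) \sum_(k < n.+1 | (k <= n - j)%N) c j k).
  apply: eq_bigr => j _; rewrite (big_ord_narrow_leq (leq_subr _ _)) /=.
  rewrite rmorph_sum big_distrr /=.
  rewrite (reindex_inj rev_ord_inj) /=; apply: eq_bigr => k _.
  have le_k : (k <= n - j)%N by rewrite -ltnS.
  rewrite subSS subKn // rmorphM mulrA /c /= iter_rmorph_comp.
  congr (_ * iter_rmorph _ _ _).
  by rewrite addnBA // subnKC // leq_ord.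
rewrite (exchange_big_dep predT) //=; apply: eq_bigr => k _.
rewrite subKn ?leq_ord // big_distrl /=.
transitivity (\sum_(j < n.+1 | (j <= n - k)%N) c j k).
  apply: eq_bigl => j; rewrite -ltnS -(ltnS j) -!subSn ?leq_ord //.
  by rewrite -subn_gt0 -(subn_gt0 j) -!subnDA addnC.
rewrite (big_ord_narrow_leq (leq_subr _ _)) /=.
by apply: eq_bigr => j _; rewrite /c subnAC.
Qed.

Fact skew_mul1 : left_id (skew_const 1) skew_mul.
Proof.
move=> f; apply/skew_pseriesP => n /=.
rewrite big_ord_recl /= mulr1n mul1r subn0 big1 ?addr0 // => i _.
by rewrite mulr0n mul0r.
Qed.

Fact skew_mulr1 : right_id (skew_const 1) skew_mul.
Proof.
move=> f; apply/skew_pseriesP => n /=.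
rewrite big_ord_recr /= subnn mulr1n rmorph1 mulr1 big1 ?add0r // => i _.
by rewrite subn_eq0 leqNgt ltn_ord mulr0n rmorph0 mulr0.
Qed.

Fact skew_mulDl : left_distributive skew_mul skew_add.
Proof.
move=> f g h; apply/skew_pseriesP => n /=; rewrite -big_split /=.
by apply: eq_bigr => i _; rewrite mulrDl.
Qed.

Fact skew_mulDr : right_distributive skew_mul skew_add.
Proof.
move=> f g h; apply/skew_pseriesP => n /=; rewrite -big_split /=.
by apply: eq_bigr => i _; rewrite rmorphD mulrDr.
Qed.

HB.instance Definition _ := GRing.isZmodule.Build S
  skew_addA skew_addC skew_add0 skew_addN.
HB.instance Definition _ := GRing.Zmodule_isPzRing.Build S
  skew_mulA skew_mul1 skew_mulr1 skew_mulDl skew_mulDr.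

Lemma scoefD f g n : scoef (f + g) n = scoef f n + scoef g n.
Proof. by []. Qed.

Lemma scoefM f g n : scoef (f * g) n =
  \sum_(i < n.+1) scoef f i * iter_rmorph alpha i (scoef g (n - i)%N).
Proof. by []. Qed.

Lemma scoef1 n : scoef (1 : S) n = (n == 0)%N%:R.
Proof. by []. Qed.

Lemma skewX_const (r : R) :
  skewX * skew_const r = skew_const (alpha r) * skewX.
Proof.
apply/skew_pseriesP => -[|n]; rewrite !scoefM.
  by rewrite !big_ord_recl !big_ord0 /= mul0r mulr0.
rewrite !big_ord_recl /= mul0r add0r mul1r mulr1n !big1 ?addr0.
- rewrite mulr0n mul0r addr0; case: n => [|n] /=; first by rewrite mulr1.
  by rewrite mulr0n mulr0 rmorph0.
- by move=> i _; rewrite mulr0n mul0r.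
- by move=> i _; rewrite mul0r.
Qed.

End SkewPSeriesRing.

(* Main.v *)
Require Import Defs.
From HB Require Import structures.
From mathcomp Require Import all_boot all_order all_algebra.
From mathcomp Require Import boolp.

(** The constant-term map R[[x; alpha]] -> R is a surjective ring morphism, and
    it reflects units: a series whose constant term is invertible is invertible
    ([is_unit_scoef0]), because its inverse can be computed coefficient by
    coefficient.  Along any surjective morphism phi that reflects units, the
    units of the source are exactly the preimages of the units of the target,
    so x lies in Delta of the source iff phi x lies in Delta of the target
    ([Delta_local]).  As phi commutes with powers, the same holds for the root
    of Delta, and factorisations a = u b can be both pushed forward along phi
    and lifted through it ([USqrtDelta_ring_local]). *)

Set Implicit Arguments.
Unset Strict Implicit.
Unset Printing Implicit Defensive.

Import GRing.Theory.
Local Open Scope ring_scope.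

Lemma is_unit_rmorph (S R : pzRingType) (phi : {rmorphism S -> R}) (f : S) :
  is_unit f -> is_unit (phi f).
Proof.
by case=> g [gf fg]; exists (phi g); rewrite -!rmorphM gf fg rmorph1.
Qed.

(** The right inverse g of f has itself a right inverse h, and then
    f = f * (g * h) = h, so g is a two-sided inverse of f.  This spares a second
    recursion for left inverses of series. *)
Lemma right_inverses_is_unit (S : pzRingType) (P : S -> Prop) :
  (forall f, P f -> exists2 g, P g & f * g = 1) ->
  forall f, P f -> is_unit f.
Proof.
move=> invP f /invP[g /invP[h _ gh] fg].
have fh : f = h by rewrite -[h]mul1r -fg -mulrA gh mulr1.
by exists g; split=> //; rewrite fh.
Qed.

Section LocalMorphism.
Variables (S R : pzRingType) (phi : {rmorphism S -> R}).
Hypothesis phi_surj : forall a, exists f, phi f = a.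
Hypothesis phi_local : forall f, is_unit (phi f) -> is_unit f.

Lemma Delta_local f : Delta (phi f) <-> Delta f.
Proof.
split=> Df u Uu.
  by apply: phi_local; rewrite rmorphD; apply/Df/is_unit_rmorph.
have [w phi_w] := phi_surj u; rewrite -phi_w in Uu *.
by rewrite -rmorphD; apply/is_unit_rmorph/Df/phi_local.
Qed.

Lemma sqrtDelta_local f : sqrtDelta (phi f) <-> sqrtDelta f.
Proof.
by split=> -[n n_gt0 Dn]; exists n => //; move: Dn; rewrite -rmorphXn Delta_local.
Qed.

Lemma USqrtDelta_ring_local : USqrtDelta_ring S <-> USqrtDelta_ring R.
Proof.
split=> [dec a|dec f] nU.
  have [f phi_f] := phi_surj a; rewrite -phi_f in nU *.
  have [Uf|u [b [Uu Db ->]]] := dec f; first by case: nU; apply: is_unit_rmorph.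
  exists (phi u), (phi b); split; [exact: is_unit_rmorph | | exact: rmorphM].
  exact/sqrtDelta_local.
have [/phi_local//|u [b [Uu Db phi_f]]] := dec (phi f).
have [w phi_w] := phi_surj u; rewrite -phi_w in Uu phi_f.
have Uw := phi_local Uu; have [v [vw wv]] := Uw.
(* w is a lift of u, so v * f = w^-1 * f is a lift of b. *)
exists w, (v * f); split=> //; last by rewrite mulrA wv mul1r.
by apply/sqrtDelta_local; rewrite rmorphM phi_f mulrA -rmorphM vw rmorph1 mul1r.
Qed.

End LocalMorphism.

Section ConstantTerm.
Variables (R : pzRingType) (alpha : {rmorphism R -> R}).
Local Notation S := (skew_pseries alpha).

Definition scoef0 (f : S) : R := scoef f 0.

Fact scoef0_is_zmod_morphism : zmod_morphism scoef0.
Proof. by []. Qed.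

Fact scoef0_is_monoid_morphism : monoid_morphism scoef0.
Proof. by split=> // f g; rewrite /scoef0 scoefM big_ord1. Qed.

HB.instance Definition _ := GRing.isZmodMorphism.Build S R scoef0
  scoef0_is_zmod_morphism.
HB.instance Definition _ := GRing.isMonoidMorphism.Build S R scoef0
  scoef0_is_monoid_morphism.

Lemma scoef0_surj (a : R) : exists f : S, scoef0 f = a.
Proof. by exists (skew_const alpha a). Qed.

(** Reversed prefixes g_(n-1), ..., g_0 of the right inverse g of f, where v is
    the inverse of f_0.  The new coefficient solves the degree n part of
    f * g = 1, which is f_0 g_n + \sum_(i < n) f_(i+1) alpha^(i+1)(g_(n-1-i)) =
    (n == 0); reversal makes g_(n-1-i) the i-th entry. *)
Fixpoint rinv_prefix (f : S) (v : R) (n : nat) : seq R :=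
  if n is m.+1 then
    let s := rinv_prefix f v m in
    v * ((m == 0)%N%:R
         - \sum_(i < m) scoef f i.+1 * iter_rmorph alpha i.+1 s`_i) :: s
  else [::].

Definition skew_rinv (f : S) (v : R) : S :=
  SkewPSeries alpha (fun n => (rinv_prefix f v n.+1)`_0).

Lemma nth_rinv_prefix f v n i : (i < n)%N ->
  (rinv_prefix f v n)`_i = scoef (skew_rinv f v) (n - i.+1).
Proof.
elim: n i => // n IHn [_|i lt_in]; first by rewrite subn1.
by rewrite subSS -IHn.
Qed.

Lemma scoef_skew_rinv f v n :
  scoef (skew_rinv f v) n = v * ((n == 0)%N%:R
    - \sum_(i < n) scoef f i.+1
        * iter_rmorph alpha i.+1 (scoef (skew_rinv f v) (n - i.+1))).
Proof.
rewrite [LHS]/=; congr (_ * (_ - _)); apply: eq_bigr => i _.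
by rewrite nth_rinv_prefix.
Qed.

Lemma skew_mul_rinv f v : scoef0 f * v = 1 -> f * skew_rinv f v = 1.
Proof.
move=> fv; apply/skew_pseriesP => n; rewrite scoefM scoef1 big_ord_recl subn0.
have fg : scoef f 0 * scoef (skew_rinv f v) n = (n == 0)%N%:R
    - \sum_(i < n) scoef f i.+1
        * iter_rmorph alpha i.+1 (scoef (skew_rinv f v) (n - i.+1)).
  by rewrite scoef_skew_rinv mulrA [_ * v]fv mul1r.
by rewrite [X in X + _]fg; apply: subrK.
Qed.

(** The right inverse of f has constant term the inverse of f_0, again a unit, so
    right invertibility of all such series already gives invertibility. *)
Lemma is_unit_scoef0 (f : S) : is_unit (scoef0 f) -> is_unit f.
Proof.
move: f; apply: right_inverses_is_unit => f [v [vf fv]].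
exists (skew_rinv f v); last exact: skew_mul_rinv.
have -> : scoef0 (skew_rinv f v) = v.
  by rewrite /scoef0 scoef_skew_rinv big_ord0 subr0 mulr1.
by exists (scoef0 f).
Qed.

End ConstantTerm.

Theorem proposition2p18 (R : pzRingType) (alpha : {rmorphism R -> R}) :
  USqrtDelta_ring (skew_pseries alpha) <-> USqrtDelta_ring R.
Proof.
exact: USqrtDelta_ring_local (@scoef0_surj R alpha) (@is_unit_scoef0 R alpha).
Qed.
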